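(* There is no exotic coBUG with a connected component isomorphic to $K_{1,6}$.
   Context: All graphs are finite, simple, undirected, with nonempty vertex set. For distinct vertices $v,w$ of a connected graph $G$, let $\sigma_{vw}$ be the number of shortest paths between $v$ and $w$, and $\sigma_{vw}(x)$ the number of those containing $x$ as an internal vertex (so $\sigma_{vw}(x)=0$ if $x\in\{v,w\}$). The betweenness of a vertex $x$ is $B_G(x)=\sum_{\{v,w\}\subseteq V(G)}\frac{\sigma_{vw}(x)}{\sigma_{vw}}$, the sum being over unordered pairs of distinct vertices. A betweenness-uniform graph (BUG) is a connected graph $G$ in which all vertices have the same betweenness; this common value is the betweenness of $G$. A low-betweenness BUG is a BUG with betweenness smaller than $1$. Stars are the graphs $K_{1,\ell}$ with $\ell\ge 0$ ($K_{1,0}$ is the single-vertex graph). An exotic BUG is a low-betweenness BUG whose complement is not a disjoint union of stars of the same size (i.e. there is no $\ell\ge0$ such that every connected component of the complement is isomorphic to $K_{1,\ell}$). An exotic coBUG is the complement of an exotic BUG. *)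

(* Defs.v *)
From mathcomp Require Import all_boot all_order all_algebra.

Set Implicit Arguments.
Unset Strict Implicit.
Unset Printing Implicit Defensive.

(* A graph is a finite vertex type T together with its adjacency relation. *)
Definition simple_graph (T : finType) (e : rel T) : Prop :=
  [/\ 0 < #|T|, symmetric e & irreflexive e].

Definition graph_compl (T : finType) (e : rel T) : rel T :=
  fun x y => (x != y) && ~~ e x y.

Definition graph_iso (S T : finType) (r : rel S) (e : rel T) : Prop :=
  exists2 f : S -> T, bijective f & forall x y, e (f x) (f y) = r x y.

Definition induced (T : finType) (e : rel T) (A : {set T}) :
  rel {x : T | x \in A} := fun u v => e (val u) (val v).

Arguments induced {T} e A u v.

Definition connected_graph (T : finType) (e : rel T) : Prop :=
  forall x y : T, connect e x y.

Definition component (T : finType) (e : rel T) (x : T) : {set T} :=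
  [set y | connect e x y].

(* K_{1,l}, with centre ord0 and the l other vertices as leaves. *)
Definition star (l : nat) : rel 'I_l.+1 :=
  fun i j => (i == ord0) != (j == ord0).

Arguments star l i j : clear implicits.

(* The sequence v :: p lists the vertices of a path from v to w; the path has
   size p edges. *)
Definition path_between (T : finType) (e : rel T) (v w : T) (p : seq T) :
  bool := [&& path e v p, last v p == w & uniq (v :: p)].

(* A path has at most #|T|.-1 edges, so the search is exhaustive; the value is
   #|T| when no path exists. *)
Definition dist (T : finType) (e : rel T) (v w : T) : nat :=
  find (fun n => [exists p : n.-tuple T, path_between e v w p]) (iota 0 #|T|).

Definition shortest_paths (T : finType) (e : rel T) (v w : T) :
  {set (dist e v w).-tuple T} := [set p | path_between e v w (val p)].

Definition sigma (T : finType) (e : rel T) (v w : T) : nat :=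
  #|shortest_paths e v w|.

Definition sigma_through (T : finType) (e : rel T) (v w x : T) : nat :=
  #|[set p in shortest_paths e v w | [&& x \in val p, x != v & x != w]]|.

(* Each unordered pair of distinct vertices is counted once, through its
   orientation (v, w) with v before w in the enumeration of T; the summand does
   not depend on the orientation, by reversal of paths. *)
Definition betweenness (T : finType) (e : rel T) (x : T) : rat :=
  (\sum_(v : T) \sum_(w : T | (enum_rank v < enum_rank w)%N)
     (sigma_through e v w x)%:R / (sigma e v w)%:R)%R.

Definition BUG_with_betweenness (T : finType) (e : rel T) (b : rat) : Prop :=
  [/\ simple_graph e, connected_graph e & forall x, betweenness e x = b].

Definition low_betweenness_BUG (T : finType) (e : rel T) : Prop :=
  exists2 b : rat, BUG_with_betweenness e b & (b < 1)%R.

Definition equal_star_union (T : finType) (e : rel T) : Prop :=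
  exists l : nat, forall x : T,
    graph_iso (induced e (component e x)) (star l).

Definition exotic_BUG (T : finType) (e : rel T) : Prop :=
  low_betweenness_BUG e /\ ~ equal_star_union (graph_compl e).

Definition exotic_coBUG (T : finType) (e : rel T) : Prop :=
  exists2 e0 : rel T, exotic_BUG e0 & e =2 graph_compl e0.

(* Main.v *)
Require Import Defs.
From mathcomp Require Import all_boot all_order all_algebra.
From mathcomp Require Import ring lra zify.

(** Let H be the coBUG, n its order, N(x) the neighbourhood of x in H, and
give an edge uv of H the weight 1 / (n - |N(u) U N(v)|). The non-adjacent pairs
of the complement G are the edges of H, and they have distance 2 in G, so the
betweenness of x is the total weight of the edges of H that do not meet N(x).
Hence the weight of the edges meeting N(x), the load of N(x), does not depend
on x; at a leaf of the component K_{1,6} it equals 6 / (n - 7). Summing the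
betweenness over all vertices also gives |E(H)| < n.

If x is a leaf at y, then N(x) is contained in N(z) for all z in N(y); equality
of the loads forces all neighbours of y to be leaves, and y has degree 6. So
every vertex of degree 1 lies in a component K_{1,6}. Let q be the number of
these components and W the set of vertices outside them. On W degrees are at least 2, and
the edge count gives sum_W deg <= 2|W| + 2q - 2. For a pair u, v in W whose edges
all meet some N(x), at most 6 edges meet {u, v}: by the edge count if q <= 2, by
the load if q >= 3, where n >= 24. Consequently deg u + deg v <= 7 for every edge
uv in W. If at most 6 edges met N(x), equality would hold throughout, N(x) would
be independent with all neighbours of degree 7 - deg x, and the number of edges
meeting N(x) would be deg x (7 - deg x) >= 10. So at least 7 edges meet N(x),
which excludes degree 2; and degrees at least 3 force n to be so large that 7
edges exceed the load. Hence W is empty and H is a union of stars K_{1,6}. *)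

Set Implicit Arguments.
Unset Strict Implicit.
Unset Printing Implicit Defensive.

Import Order.TTheory GRing.Theory Num.Theory.

(** * Shortest paths with at most two edges *)

Definition nbh (T : finType) (e : rel T) (u : T) : {set T} := [set v | e u v].

Lemma sigma_through_adjacent (T : finType) (e : rel T) (v w x : T) :
  v != w -> e v w -> sigma_through e v w x = 0.
Proof.
move=> vw evw; have T1 : 1 < #|T|.
  by rewrite (cardD1 v) (cardD1 w) !inE eq_sym vw.
have d1 : dist e v w = 1.
  rewrite /dist; case: #|T| T1 => [|[|k]] //= _.
  case: existsP => [[p]|_].
    by rewrite /path_between tuple0 /= (negbTE vw).
  case: existsP => // -[]; exists [tuple w].
  by rewrite /path_between /= evw eqxx inE vw.
rewrite /sigma_through /shortest_paths.
(* The type of the tuples depends on [dist e v w], so the distance is generalized before being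
   replaced by 1. *)
move: (dist e v w) d1 => _ ->.
apply/eqP; rewrite cards_eq0 -subset0; apply/subsetP => p; rewrite !inE.
case/andP=> /and3P[_ pw _] /and3P[xp _ /negP[]].
case: (tupleP p) pw xp => a q; rewrite (tuple0 q) /= => /eqP <-.
by rewrite inE.
Qed.

(** A tuple omits the start [v] and ends in [w], so a path with two edges is determined by its
    midpoint [thead p]. *)
Lemma card_paths2 (T : finType) (e : rel T) (v w : T) (P : pred T) :
  v != w ->
  #|[set p : 2.-tuple T | path_between e v w p && P (thead p)]| =
  #|[set a | [&& a != v, a != w, e v a, e a w & P a]]|.
Proof.
move=> vw; rewrite -(card_imset _ (f := fun a => [tuple a; w])); last first.
  by move=> a b /(congr1 val) [].
apply: eq_card => p; rewrite !inE; apply/idP/imsetP.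
  case: (tupleP p) => a q; case: (tupleP q) => b r; rewrite (tuple0 r) /=.
  case/andP=> /and3P[/and3P[va ab _] /eqP /= bw /and3P[]].
  rewrite !inE theadE => av' ba' _ Pa; exists a; last first.
    by apply: val_inj; rewrite /= bw.
  move: av' ba'; rewrite !inE negb_or bw in ab * => /andP[av' _] ba'.
  by rewrite eq_sym av' ba' va ab.
case=> a; rewrite inE => /and5P[av aw va ab Pa] ->.
rewrite /path_between /= va ab eqxx !inE negb_or eq_sym av vw aw /=.
by rewrite theadE.
Qed.

Lemma dist_nonadjacent (T : finType) (e : rel T) (v w a : T) :
  v != w -> ~~ e v w -> a != v -> a != w -> e v a -> e a w -> dist e v w = 2.
Proof.
move=> vw nvw av aw va aw'; have T2 : 2 < #|T|.
  by rewrite (cardD1 v) (cardD1 w) (cardD1 a) !inE aw av eq_sym vw.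
rewrite /dist; case: #|T| T2 => [|[|[|k]]] //= _.
case: existsP => [[p]|_].
  by rewrite /path_between tuple0 /= (negbTE vw).
case: existsP => [[p]|_].
  case: (tupleP p) => b q; rewrite (tuple0 q) /path_between /=.
  by case/and3P=> /andP[vb _] /eqP bw _; rewrite bw (negbTE nvw) in vb.
case: existsP => // -[]; exists [tuple a; w].
by rewrite /path_between /= va aw' eqxx !inE negb_or eq_sym av vw aw.
Qed.

(** * Betweenness as a sum of edge weights of the complement *)

Definition span (T : finType) (e : rel T) (u v : T) : nat :=
  #|nbh e u :|: nbh e v|.

(** For an edge of the coBUG, the vertices outside the union in [span] are the common neighbours in
    the complement; the weight is the inverse of their number. *)
Definition weight (T : finType) (e : rel T) (u v : T) : rat :=
  ((#|T|%:R - (span e u v)%:R)^-1)%R.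

(* Every undirected edge is represented by one orientation, as in
   [betweenness]. *)
Definition edges_meeting (T : finType) (e : rel T) (X : {set T}) : {set T * T} :=
  [set p | [&& enum_rank p.1 < enum_rank p.2, e p.1 p.2
             & (p.1 \in X) || (p.2 \in X)]].

(** The bound on [span] yields a common neighbour of [v] and [w], so their distance is 2 and the
    shortest paths correspond to their midpoints, the vertices outside the union. *)
Lemma sigma_compl (T : finType) (e : rel T) (v w x : T) :
  symmetric e -> v != w -> ~~ e v w -> span (graph_compl e) v w < #|T| ->
  sigma e v w = #|T| - span (graph_compl e) v w /\
  sigma_through e v w x =
    (x \notin nbh (graph_compl e) v :|: nbh (graph_compl e) w).
Proof.
move=> es vw nvw dT; set U := _ :|: _.
have inU a : (a \notin U) = [&& a != v, a != w, e v a & e a w].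
  rewrite !inE /graph_compl negb_or !negb_and !negbK (es w a).
  rewrite [v == a]eq_sym [w == a]eq_sym.
  case: (eqVneq a v) => [->|av] /=; first by rewrite (negbTE vw) (negbTE nvw).
  by case: (eqVneq a w) => [->|] //=; rewrite (negbTE nvw).
have cU : #|~: U| = #|T| - span (graph_compl e) v w.
  by rewrite cardsCs setCK.
have /card_gt0P[a] : 0 < #|~: U| by rewrite cU subn_gt0.
rewrite inE inU => /and4P[av aw va aw'].
have := dist_nonadjacent vw nvw av aw va aw'.
rewrite /sigma_through /sigma /shortest_paths.
move: (dist e v w) => k ->; split.
  rewrite -cU.
  transitivity #|[set p : 2.-tuple T | path_between e v w p && predT (thead p)]|.
    by apply: eq_card => p; rewrite !inE andbT.
  rewrite card_paths2 //; apply: eq_card => b.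
  by rewrite in_setC inU !inE andbT.
(* The tuple ends in [w], so for [x != w] lying on it means being its head. *)
transitivity #|[set p : 2.-tuple T | path_between e v w p
                  && [&& x == thead p, x != v & x != w]]|.
  apply: eq_card => p; rewrite !inE.
  case: (tupleP p) => b q; case: (tupleP q) => c r; rewrite (tuple0 r) theadE.
  case pb: (path_between _ _ _ _) => //=.
  case/and3P: pb => _ /eqP /= -> _; rewrite !inE.
  by case: (x == w); rewrite ?andbF ?orbF.
rewrite (card_paths2 e [pred y | [&& x == y, x != v & x != w]] vw).
case: (boolP (x \in U)) => /= [xU|].
  apply/eqP; rewrite cards_eq0 -subset0; apply/subsetP => b; rewrite !inE.
  case/and5P => bv bw vb bw' /andP[/eqP xb _].
  by rewrite xb -[_ \in _]negbK inU bv bw vb bw' in xU.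
rewrite inU => /and4P[xv xw vx xw']; rewrite -[RHS](cards1 x).
apply: eq_card => b; rewrite !inE /= [b == x]eq_sym.
by case: (eqVneq x b) => [<-|]; rewrite ?andbF // xv xw vx xw'.
Qed.

Local Open Scope ring_scope.

(** An edge with [x] outside both neighbourhoods has exactly one shortest path through [x]; all
    other pairs contribute 0. *)
Lemma betweenness_compl (T : finType) (e : rel T) (x : T) :
  let c := graph_compl e in
  symmetric e -> (forall u v, c u v -> (span c u v < #|T|)%N) ->
  betweenness e x =
  \sum_(p in edges_meeting c setT | x \notin nbh c p.1 :|: nbh c p.2)
    weight c p.1 p.2.
Proof.
move=> c es dT; rewrite /betweenness pair_big_dep /=.
rewrite [LHS](bigID (fun p => (c p.1 p.2) && (x \notin nbh c p.1 :|: nbh c p.2))).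
rewrite /= [X in _ + X]big1 ?addr0 => [|[v w] /= /andP[vw]].
  apply: eq_big => [[v w]|[v w] /=].
    by rewrite !inE /= andbT andbA.
  case/andP=> _ /andP[cvw nU]; have [nvw evw] := andP cvw.
  have [-> ->] := sigma_compl x es nvw evw (dT _ _ cvw).
  by rewrite nU mul1r natrB // ltnW // dT.
have nvw : v != w by apply: contraTneq vw => ->; rewrite ltnn.
rewrite negb_and negbK => h.
case: (boolP (e v w)) => evw; first by rewrite sigma_through_adjacent // mul0r.
have cvw : c v w by rewrite /c /graph_compl nvw.
have [_ ->] := sigma_compl x es nvw evw (dT _ _ cvw).
by move: h; rewrite cvw /= => ->; rewrite mul0r.
Qed.

Lemma sum_before (T : finType) (R : nmodType) (k : T -> T -> R) :
  (forall u, k u u = 0) ->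
  \sum_(p : T * T | (enum_rank p.1 < enum_rank p.2)%N)
     (k p.1 p.2 + k p.2 p.1) = \sum_u \sum_v k u v.
Proof.
move=> k0; rewrite pair_big /= big_split /=.
rewrite [RHS](bigID (fun p => (enum_rank p.1 < enum_rank p.2)%N)) /=.
congr (_ + _).
rewrite [RHS](bigID (fun p => p.1 == p.2)) /= [X in _ = X + _]big1 ?add0r.
  rewrite (reindex_inj (h := fun p => (p.2, p.1))) /=; last first.
    by case=> [a b] [c d] [-> ->].
  apply: eq_bigl => -[u v] /=; rewrite -leqNgt ltn_neqAle andbC.
  by rewrite (inj_eq val_inj) (inj_eq enum_rank_inj) eq_sym.
by case=> u v /= /andP[_ /eqP->].
Qed.

(** An edge inside [X] is seen from both ends, an edge with one end in [X] only from that end; the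
    factors 1 and 2 make each count twice. *)
Lemma sum_edges_meeting (T : finType) (e : rel T) (X : {set T})
    (f : T -> T -> rat) :
  symmetric e -> irreflexive e -> (forall u v, f u v = f v u) ->
  (\sum_(p in edges_meeting e X) f p.1 p.2) *+ 2 =
  \sum_(u in X) \sum_(v in nbh e u) f u v *+ (if v \in X then 1 else 2).
Proof.
move=> es ei fs.
pose k u v := if (u \in X) && e u v then f u v *+ (if v \in X then 1 else 2)
              else 0.
transitivity (\sum_u \sum_v k u v); last first.
  rewrite [RHS]big_mkcond; apply: eq_bigr => u _; rewrite /k.
  case: (u \in X) => /=; last by rewrite big1.
  by rewrite [RHS]big_mkcond; apply: eq_bigr => v _; rewrite inE.
rewrite -sum_before => [|u]; last by rewrite /k ei andbF.
rewrite -sumrMnl big_mkcond [RHS]big_mkcond; apply: eq_bigr => -[u v] _ /=.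
rewrite inE /=; case: ifP => [/and3P[-> euv]|].
  rewrite /k es (es v u) euv !andbT [f v u]fs.
  by case: (u \in X); case: (v \in X) => //= _; rewrite ?add0r ?addr0 ?mulr2n ?mulr1n.
case: (enum_rank u < enum_rank v)%N => //=; rewrite /k es (es v u).
case: (e u v); rewrite ?andbF ?addr0 //= => /negbT.
by rewrite negb_or => /andP[/negbTE-> /negbTE->]; rewrite addr0.
Qed.

(** * Inequalities for [x / (N - 1 - x)] *)

Lemma ratio_le (N x y : rat) :
  0 <= x -> x <= y -> y < N - 1 -> x / (N - 1 - x) <= y / (N - 1 - y).
Proof.
move=> x0 xy yN; apply: ler_pM => //; first by rewrite invr_ge0; lra.
by rewrite lef_pV2 ?posrE; lra.
Qed.

(* The function a / (n - 1 - a) is convex and vanishes at 0, so the sum could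
   fall below its value at a + c; the slack between 6 and 7 compensates for
   this once n >= 22. *)
Lemma ratio_add_gt (n a c : nat) :
  (24 <= n)%N -> (0 < a)%N -> (0 < c)%N -> (7 <= a + c)%N ->
  (a.+1 < n)%N -> (c.+1 < n)%N ->
  6 / (n%:R - 7) < a%:R / (n%:R - 1 - a%:R) + c%:R / (n%:R - 1 - c%:R) :> rat.
Proof.
wlog ca : a c / (c <= a)%N => [hw|] n24 a0 c0 ac an cn.
  have [ca|/ltnW ca] := leqP c a; first exact: hw.
  by rewrite [X in _ < X]addrC; apply: hw => //; rewrite addnC.
have nat_le (k m : nat) : (k <= m)%N -> k%:R <= m%:R :> rat by rewrite ler_nat.
have /nat_le N24 := n24; have /nat_le aN := an; have /nat_le cN := cn.
rewrite -!natr1 in aN cN.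
set N : rat := n%:R in N24 aN cN *.
have mono k m : (k <= m)%N -> m%:R + 1 + 1 <= N ->
    k%:R / (N - 1 - k%:R) <= m%:R / (N - 1 - m%:R) :> rat.
  by move=> /nat_le km mN; apply: ratio_le => //; lra.
(* As [c <= a] and [7 <= a + c], either [a >= 6], or [a = 5] and [c >= 2], or [a = 4] and
   [c >= 3]. *)
have [a6|a5] := leqP 6 a.
  have := mono _ _ a6 aN; have : 0 < c%:R / (N - 1 - c%:R).
    by rewrite divr_gt0 ?ltr0n // ; lra.
  by rewrite [N - 1 - 6%:R](_ : _ = N - 7); lra.
have [a5'|a4] := leqP 5 a.
  have := mono _ _ a5' aN; have c2 : (2 <= c)%N by lia.
  have := mono _ _ c2 cN.
  suff : 6 / (N - 7) < 5 / (N - 1 - 5) + 2 / (N - 1 - 2) by lra.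
  rewrite -subr_gt0.
  have -> : 5 / (N - 1 - 5) + 2 / (N - 1 - 2) - 6 / (N - 7) =
            (N * (N - 22) + 81) / ((N - 7) * (N - 6) * (N - 3)).
    by field; rewrite !gt_eqF //; lra.
  by rewrite divr_gt0 ?mulr_gt0 //; nra.
have a4' : (4 <= a)%N by lia.
have := mono _ _ a4' aN; have c3 : (3 <= c)%N by lia.
have := mono _ _ c3 cN.
suff : 6 / (N - 7) < 4 / (N - 1 - 4) + 3 / (N - 1 - 3) by lra.
rewrite -subr_gt0.
have -> : 4 / (N - 1 - 4) + 3 / (N - 1 - 3) - 6 / (N - 7) =
          (N * (N - 26) + 97) / ((N - 7) * (N - 5) * (N - 4)).
  by field; rewrite !gt_eqF //; lra.
by rewrite divr_gt0 ?mulr_gt0 //; nra.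
Qed.

(** Local form, without subtypes, of the statement that the component of [c] is a star with centre
    [c]. *)
Definition star_center (T : finType) (e : rel T) (k : nat) (c : T) : Prop :=
  #|nbh e c| = k /\ forall z, z \in nbh e c -> nbh e z = [set c].

(** * Loads in a coBUG with a component [K_{1,6}] *)

Section LowBetweenness.

Variables (T : finType) (e : rel T) (b : rat).
Hypotheses (es : symmetric e) (ei : irreflexive e).
Hypothesis spanT : forall u v, e u v -> (span e u v < #|T|)%N.
Hypothesis betweenE : forall x,
  \sum_(p in edges_meeting e setT | x \notin nbh e p.1 :|: nbh e p.2)
    weight e p.1 p.2 = b.
Hypothesis b1 : b < 1.
Variable c0 : T.
Hypothesis c0P : star_center e 6 c0.

Local Notation n := #|T|.
Local Notation N := (nbh e).
Local Notation deg u := #|N u|.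
Local Notation load X :=
  (\sum_(p in edges_meeting e X) weight e p.1 p.2).

Lemma nbhC u v : (u \in N v) = (v \in N u).
Proof. by rewrite !inE es. Qed.

Lemma nbhx u : (u \in N u) = false.
Proof. by rewrite inE ei. Qed.

Lemma weightC u v : weight e u v = weight e v u.
Proof. by rewrite /weight /span setUC. Qed.

Lemma weight_gt0 u v : e u v -> 0 < weight e u v.
Proof. by move=> /spanT h; rewrite invr_gt0 subr_gt0 ltr_nat. Qed.

Lemma weight_ge u v k : e u v -> (k <= span e u v)%N ->
  (n%:R - k%:R)^-1 <= weight e u v.
Proof.
move=> /spanT h ks; have hk := leq_ltn_trans ks h.
by rewrite lef_pV2 ?posrE ?subr_gt0 ?ltr_nat // lerD2l lerN2 ler_nat.
Qed.

Lemma weight_le u v k : e u v -> (span e u v <= k < n)%N ->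
  weight e u v <= (n%:R - k%:R)^-1.
Proof.
move=> /spanT h /andP[sk kn].
by rewrite lef_pV2 ?posrE ?subr_gt0 ?ltr_nat // lerD2l lerN2 ler_nat.
Qed.

Lemma span_geS u v : e u v -> (deg u < span e u v)%N.
Proof.
move=> uv; apply: proper_card; apply/properP; split; first exact: subsetUl.
by exists u; rewrite ?nbhx // inE !inE es uv orbT.
Qed.

Lemma deg_ltn u v : e u v -> ((deg u).+1 < n)%N.
Proof. by move=> uv; apply: leq_ltn_trans (span_geS uv) (spanT uv). Qed.

Lemma edges_meetingS (X Y : {set T}) : X \subset Y ->
  edges_meeting e X \subset edges_meeting e Y.
Proof.
move=> /subsetP XY; apply/subsetP => p; rewrite !inE => /and3P[-> -> /=].
by case/orP=> /XY ->; rewrite ?orbT.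
Qed.

Lemma edges_meeting_edge X p : p \in edges_meeting e X -> e p.1 p.2.
Proof. by rewrite inE => /and3P[]. Qed.

Lemma load_meeting_le X Y : edges_meeting e X \subset edges_meeting e Y ->
  load X <= load Y.
Proof.
move=> XY; rewrite [leRHS](big_setID (edges_meeting e X)) /=.
rewrite (setIidPr XY) lerDl sumr_ge0 // => p; rewrite inE => /andP[_].
by move/edges_meeting_edge/weight_gt0/ltW.
Qed.

(** Edges have positive weight, so a proper inclusion would change the load. *)
Lemma edges_meeting_eq X Y : edges_meeting e X \subset edges_meeting e Y ->
  load X = load Y -> edges_meeting e X = edges_meeting e Y.
Proof.
move=> XY; rewrite [RHS](big_setID (edges_meeting e X)) /=.
rewrite (setIidPr XY) => /eqP; rewrite -subr_eq0 opprD addNKr oppr_eq0 => l0.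
apply/eqP; rewrite eqEsubset XY -setD_eq0 -subset0 /=.
apply/subsetP => p pD; have := pD; rewrite inE => /andP[_].
move/edges_meeting_edge/weight_gt0.
move: l0; rewrite psumr_eq0 => [/allP/(_ p)|q].
  by rewrite mem_index_enum pD => /(_ isT) /eqP ->; rewrite ltxx.
by rewrite inE => /andP[_] /edges_meeting_edge/weight_gt0/ltW.
Qed.

Lemma load2 X : load X *+ 2 =
  \sum_(u in X) \sum_(v in N u) weight e u v *+ (if v \in X then 1 else 2).
Proof. by apply: sum_edges_meeting => //; apply: weightC. Qed.

Lemma card_meeting2 X : (#|edges_meeting e X| * 2 =
  \sum_(u in X) \sum_(v in N u) (if v \in X then 1 else 2))%N.
Proof.
apply/eqP; rewrite -(eqr_nat rat) natrM mulr_natr -sum1_card !natr_sum.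
apply/eqP; rewrite (sum_edges_meeting _ (f := fun _ _ => 1%:R)) //.
by apply: eq_bigr => u _; rewrite natr_sum.
Qed.

(** For a leaf [v] at [y] the union in [span] is [N y] together with [y]. *)
Lemma load_leaves y : (forall z, z \in N y -> N z = [set y]) ->
  load [set y] = (deg y)%:R / (n%:R - 1 - (deg y)%:R).
Proof.
move=> leaf; have := load2 [set y]; rewrite big_set1.
rewrite [X in _ = X -> _](eq_bigr (fun _ => (n%:R - 1 - (deg y)%:R)^-1 *+ 2)) => [|v vy].
  rewrite sumr_const -mulrnA mulnC mulrnA mulr_natl => /eqP.
  by rewrite eqr_pMn2r // => /eqP.
rewrite inE; case: eqP vy => [->|_ vy]; first by rewrite nbhx.
rewrite /weight /span (leaf _ vy) setUC cardsU1 nbhx add1n -natr1.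
by rewrite opprD addrA addrAC.
Qed.

(** Since [x] lies in [N u] or [N v] exactly when [u] or [v] lies in [N x], the load of [N x] is the
    total weight minus [b]. *)
Lemma load_nbh x : load (N x) = 6 / (n%:R - 7).
Proof.
have load_const y : load (N y) = load setT - b.
  rewrite -(betweenE y) [in RHS](bigID (fun p => y \notin N p.1 :|: N p.2)) /=.
  rewrite [X in _ = X - _]addrC addrK; apply: eq_bigl => p.
  rewrite !inE negbK /= andbT -!andbA; congr [&& _, _ & _].
  by rewrite ![e y _]es.
have [d6 leaf] := c0P.
have /card_gt0P[l lc] : (0 < deg c0)%N by rewrite d6.
rewrite load_const -(load_const l) (leaf _ lc) load_leaves // d6.
by congr (_ / _); rewrite -addrA -opprD.
Qed.

(** An edge contributes its weight at [n - span] vertices, hence 1 in total; so [n * b] is the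
    number of edges. *)
Lemma card_edges_lt : (#|edges_meeting e setT| < n)%N.
Proof.
have : \sum_(x : T) b = #|edges_meeting e setT|%:R.
  rewrite -(eq_bigr _ (fun x _ => betweenE x)).
  under eq_bigr do rewrite big_mkcondr.
  rewrite exchange_big /= -sum1_card natr_sum; apply: eq_bigr => p.
  move/edges_meeting_edge/spanT => sp; rewrite -big_mkcond sumr_const /=.
  have <- : (n - span e p.1 p.2)%N = #|[predC N p.1 :|: N p.2]|.
    by rewrite -(cardC (mem (N p.1 :|: N p.2))) addKn.
  rewrite -[LHS]mulr_natl /weight -natrB ?(ltnW sp) // divff //.
  by rewrite pnatr_eq0 -lt0n subn_gt0.
rewrite sumr_const -[b *+ _]mulr_natr => bE; rewrite -(ltr_nat rat) -bE.
rewrite -[ltRHS]mul1r ltr_pM2r // ltr0n; apply/card_gt0P; by exists c0.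
Qed.

Lemma deg_sum_le : (\sum_u deg u + 2 <= 2 * n)%N.
Proof.
have -> : (\sum_u deg u = #|edges_meeting e setT| * 2)%N.
  rewrite card_meeting2; apply: eq_big => u; first by rewrite inE.
  by rewrite -sum1_card; under [RHS]eq_bigr do rewrite inE.
by have := card_edges_lt; lia.
Qed.

(** * Vertices of small degree *)

Lemma card_gt7 : (7 < n)%N.
Proof.
have [d6 leaf] := c0P; have /card_gt0P[l lc] : (0 < deg c0)%N by rewrite d6.
by have := @deg_ltn c0 l; rewrite d6; apply; rewrite inE in lc.
Qed.

(** An isolated vertex would have load 0, whereas [6 / (n - 7)] is nonzero because [n > 7]. *)
Lemma deg_gt0 x : (0 < deg x)%N.
Proof.
have n7 := card_gt7.
rewrite lt0n; apply: contraTneq isT => /eqP; rewrite cards_eq0 => /eqP x0.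
have := load_nbh x; rewrite x0 big_pred0 => [/esym/eqP|p].
  by rewrite mulf_eq0 invr_eq0 subr_eq0 eqr_nat gtn_eqF.
by rewrite !inE !andbF.
Qed.

(** For [z] in [N y], the sets [N x] and [N z] have equal loads, and [N x] is contained in [N z]. An
    edge from [z] to some [w != y] would meet [N z] but not [N x]. *)
Lemma leaf_center x y : N x = [set y] -> star_center e 6 y.
Proof.
move=> xy; have yx : y \in N x by rewrite xy set11.
have leaf z : z \in N y -> N z = [set y].
  move=> zy; have yz : y \in N z by rewrite nbhC.
  have sub : edges_meeting e (N x) \subset edges_meeting e (N z).
    by apply: edges_meetingS; rewrite xy sub1set.
  have eqE : edges_meeting e (N x) = edges_meeting e (N z).
    by apply: edges_meeting_eq => //; rewrite !load_nbh.
  apply/eqP; rewrite eqEsubset sub1set yz andbT; apply/subsetP => w wz.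
  have zw : z != w by apply: contraTneq wz => ->; rewrite nbhx.
  have ezw : e z w by rewrite inE in wz.
  have ewz : e w z by rewrite es.
  have : ((z, w) \in edges_meeting e (N z)) || ((w, z) \in edges_meeting e (N z)).
    rewrite !inE /= ei ezw ewz !andbT.
    by case: ltngtP => // /val_inj/enum_rank_inj /eqP; rewrite (negbTE zw).
  have zy' : z != y by apply: contraTneq zy => ->; rewrite nbhx.
  rewrite -eqE xy !inE /= (negbTE zy') orbF /=.
  by case/orP => /and3P[_ _].
split=> //; have := load_nbh x; rewrite xy load_leaves // => h.
have /deg_ltn : e y x by rewrite -[e y x]inE -/(N y) -nbhC.
rewrite -(ltr_nat rat) -natr1 => yn.
have n7 : 7%:R < n%:R :> rat by rewrite ltr_nat card_gt7.
have [d1 d2] : n%:R - 1 - (deg y)%:R != 0 :> rat /\ n%:R - 7 != 0 :> rat.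
  by split; rewrite gt_eqF //; lra.
(* Cross-multiplying [a / (n - 1 - a) = 6 / (n - 7)] gives [(a - 6) * (n - 1) = 0]. *)
move/eqP: h; rewrite eqr_div // => /eqP h.
have /eqP : ((deg y)%:R - 6) * (n%:R - 1) = 0 :> rat by lra.
rewrite mulf_eq0 [n%:R - 1 == 0]gt_eqF; last by lra.
by rewrite orbF subr_eq0 eqr_nat => /eqP.
Qed.

(** * Vertices outside the star components *)

Definition leaves : {set T} := [set x | deg x == 1].
Definition centers : {set T} := [set y | [exists x in leaves, y \in N x]].
(** This is the set W of the overview; [#|centers|] is its q. *)
Definition inner : {set T} := ~: (leaves :|: centers).

Lemma centerP y : y \in centers -> star_center e 6 y.
Proof.
rewrite inE => /exists_inP[x]; rewrite inE => /cards1P[z xz].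
by rewrite xz inE => /eqP->; apply: leaf_center xz.
Qed.

Lemma center_nbh_leaf y z : y \in centers -> z \in N y -> z \in leaves.
Proof. by move/centerP=> [_ h] /h zy; rewrite inE zy cards1. Qed.

Lemma inner_deg x : x \in inner -> (1 < deg x)%N.
Proof.
by rewrite !inE negb_or ltn_neqAle deg_gt0 andbT eq_sym => /andP[].
Qed.

Lemma inner_nbh x y : x \in inner -> y \in N x -> y \in inner.
Proof.
rewrite !in_setC !in_setU !negb_or => /andP[xl xc] yx.
rewrite -nbhC in yx; apply/andP; split; last first.
  by apply: contra xl => yc; apply: center_nbh_leaf yc _.
by apply: contra xc => yl; rewrite inE; apply/exists_inP; exists y.
Qed.

(** Each star component has 7 vertices and degree sum 12, which is subtracted from [deg_sum_le]. *)
Lemma inner_deg_sum :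
  (\sum_(x in inner) deg x + 2 <= 2 * #|inner| + 2 * #|centers|)%N /\
  n = (#|inner| + 7 * #|centers|)%N.
Proof.
have dis : [disjoint leaves & centers].
  rewrite -setI_eq0 -subset0; apply/subsetP => x; rewrite inE => /andP[].
  by rewrite inE => /eqP h /centerP[]; rewrite h.
have deg_centers : (\sum_(x in centers) deg x = 6 * #|centers|)%N.
  rewrite mulnC -sum_nat_const; apply: eq_bigr => x /centerP[] //.
have deg_leaves : (\sum_(x in leaves) deg x = #|leaves|)%N.
  by rewrite -sum1_card; apply: eq_bigr => x; rewrite inE => /eqP.
have card_leaves : (#|leaves| = 6 * #|centers|)%N.
  rewrite -deg_leaves -deg_centers.
  (* The edges between leaves and centers are counted from both sides. *)
  under eq_bigr do rewrite -sum1_card.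
  under [RHS]eq_bigr do rewrite -sum1_card.
  rewrite (exchange_big_dep (mem centers)) /=; last first.
    by move=> x y xl yx; rewrite inE; apply/exists_inP; exists x.
  apply: eq_bigr => y yc; apply: eq_bigl => x; rewrite nbhC.
  by case: (boolP (x \in N y)) => [/(center_nbh_leaf yc)->|]; rewrite ?andbF.
have cardU : #|leaves :|: centers| = (7 * #|centers|)%N.
  by rewrite cardsU disjoint_setI0 // cards0 card_leaves; lia.
have nE : n = (#|inner| + 7 * #|centers|)%N by rewrite -cardU addnC cardsC.
split=> //; have := deg_sum_le.
rewrite (bigID (mem inner)) /=.
rewrite [X in (_ + X + _)%N](eq_bigl (fun x => x \in [predU leaves & centers])).
  rewrite bigU //= deg_leaves deg_centers card_leaves nE; lia.
by move=> x; rewrite /inner !inE negbK.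
Qed.

Lemma span_le u v : (span e u v <= deg u + deg v)%N.
Proof. exact: leq_card_setU. Qed.

Lemma card_inner_gt2 x : x \in inner -> (2 < #|inner|)%N.
Proof.
move=> xi; have : x |: N x \subset inner.
  by apply/subsetP => y /setU1P[-> //|]; apply: inner_nbh.
move/subset_leq_card; rewrite cardsU1 nbhx add1n.
by apply: leq_ltn_trans; apply: inner_deg.
Qed.

(** The other inner vertices have degree at least 2 and use up all but this much of the bound on the
    degree sum. *)
Lemma inner_pair_deg x y : x \in inner -> y \in inner -> x != y ->
  (deg x + deg y <= 2 * #|centers| + 2)%N.
Proof.
move=> xi yi xy; have [+ _] := inner_deg_sum.
have := card_inner_gt2 xi.
rewrite (cardD1 x inner) xi (cardD1 y [predD1 inner & x]) inE /= eq_sym xy yi.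
rewrite (bigD1 x) //= (bigD1 y) /=; last by rewrite yi eq_sym.
set k := #|[predD1 _ & y]|; set s := (\sum_(i | _) _)%N.
suff : (k * 2 <= s)%N by lia.
rewrite -sum_nat_const [leqLHS](eq_bigl (fun i => (i \in inner) && (i != x) && (i != y))).
  by apply: leq_sum => z /andP[/andP[/inner_deg]].
by move=> z; rewrite !inE; case: (z == x); case: (z == y); rewrite ?andbF ?andbT.
Qed.

(** * Edges meeting a pair of vertices *)

Lemma sum_meeting_pair u v (f : T -> T -> rat) :
  u != v -> (forall x y, f x y = f y x) ->
  \sum_(p in edges_meeting e [set u; v]) f p.1 p.2 =
  \sum_(z in N u) f u z + \sum_(z in N v :\ u) f v z.
Proof.
move=> uv fs; apply/eqP; rewrite -(eqr_pMn2r (n := 2)) //; apply/eqP.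
rewrite (sum_edges_meeting _ es ei fs) big_setU1 ?inE //= big_set1.
(* A possible edge [u v] is counted at [u] only, whence [N v :\ u]. *)
case: (boolP (e u v)) => euv.
  have vNu : v \in N u by rewrite inE.
  have uNv : u \in N v by rewrite nbhC.
  rewrite (big_setD1 v) // (big_setD1 u uNv) [\sum_(z in N u) _](big_setD1 v) //=.
  rewrite !inE !eqxx orbT /= [f v u]fs !mulrnDl -!sumrMnl.
  have -> : \sum_(i in N u :\ v) f u i *+ (if i \in [set u; v] then 1 else 2)
          = \sum_(i in N u :\ v) f u i *+ 2.
    apply: eq_bigr => z; rewrite !inE => /andP[/negbTE-> uz].
    by case: eqP uz => // ->; rewrite ei.
  have -> : \sum_(i in N v :\ u) f v i *+ (if i \in [set u; v] then 1 else 2)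
          = \sum_(i in N v :\ u) f v i *+ 2.
    apply: eq_bigr => z; rewrite !inE => /andP[/negbTE-> vz].
    by case: eqP vz => // ->; rewrite ei.
  by rewrite !mulr2n !mulr1n; lra.
have Nvu : N v :\ u = N v.
  apply/setP => z; rewrite !inE andbC.
  by case: (eqVneq z u) => [->|]; rewrite ?andbT // es (negbTE euv).
rewrite Nvu mulrnDl -!sumrMnl; congr (_ + _); apply: eq_bigr => z; rewrite !inE.
  case: eqP => [->|_]; first by rewrite ei.
  by case: eqP => [->|//]; rewrite (negbTE euv).
case: eqP => [->|_]; first by rewrite es (negbTE euv).
by case: eqP => [->|//]; rewrite ei.
Qed.

Lemma card_meeting_pair u v : u != v ->
  #|edges_meeting e [set u; v]| = (deg u + #|N v :\ u|)%N.
Proof.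
move=> uv; apply/eqP; rewrite -(eqr_nat rat) natrD -!sum1_card !natr_sum.
by rewrite (sum_meeting_pair (f := fun _ _ => 1%:R)).
Qed.

(** An edge at [y] has span greater than [deg y]; at [v] the degree is lowered to the number of
    edges counted, to match [ratio_add_gt]. *)
Lemma load_pair_ge u v : u != v ->
  (deg u)%:R / (n%:R - 1 - (deg u)%:R) +
  #|N v :\ u|%:R / (n%:R - 1 - #|N v :\ u|%:R) <= load [set u; v].
Proof.
move=> uv; rewrite (sum_meeting_pair uv weightC).
have wt_ge y z k : e y z -> (k <= deg y)%N ->
    (n%:R - 1 - k%:R)^-1 <= weight e y z.
  move=> yz ky; rewrite -addrA -opprD nat1r; apply: weight_ge => //.
  exact: leq_ltn_trans ky (span_geS yz).
apply: lerD; rewrite mulr_natl -sumr_const; apply: ler_sum => z.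
  by rewrite inE => /wt_ge; apply.
by rewrite !inE => /andP[_] /wt_ge; apply; apply: subset_leq_card (subD1set _ _).
Qed.

(* With at most two star components the bound comes from the number of edges,
   with more it comes from the load, n being at least 24. *)
Lemma meeting_pair_le6 x u v :
  u \in inner -> v \in inner -> u != v ->
  edges_meeting e [set u; v] \subset edges_meeting e (N x) ->
  (#|edges_meeting e [set u; v]| <= 6)%N.
Proof.
move=> ui vi uv sub; rewrite card_meeting_pair // leqNgt; apply/negP => gt6.
have cpos : (0 < #|N v :\ u|)%N.
  by have := inner_deg vi; rewrite (cardsD1 u (N v)); case: (u \in N v) => /=; lia.
have ca : (#|N v :\ u| <= deg v)%N by apply: subset_leq_card (subD1set _ _).
have [q2|q3] := leqP #|centers| 2.
  by have := inner_pair_deg ui vi uv; lia.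
(* Three stars with 7 vertices each and at least 3 inner vertices. *)
have n24 : (24 <= n)%N.
  by have [_ ->] := inner_deg_sum; have := card_inner_gt2 ui; lia.
have deg_lt w : ((deg w).+1 < n)%N.
  have /card_gt0P[z] := deg_gt0 w; rewrite inE; exact: deg_ltn.
have := load_pair_ge uv; have := load_meeting_le sub; rewrite load_nbh.
have := ratio_add_gt n24 (deg_gt0 u) cpos gt6 (deg_lt u)
  (leq_ltn_trans (_ : (_ < _)%N) (deg_lt v)).
rewrite ltnS => /(_ ca) /=; lra.
Qed.

(** Every edge at [u] or [v] meets [N u], and the edge [u v] is counted once in the bound 6. *)
Lemma inner_edge_deg u v : u \in inner -> e u v -> (deg u + deg v <= 7)%N.
Proof.
move=> ui euv; have vNu : v \in N u by rewrite inE.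
have uv : u != v by apply: contraTneq vNu => ->; rewrite nbhx.
have := @meeting_pair_le6 u u v ui (inner_nbh ui vNu) uv.
rewrite card_meeting_pair // (cardsD1 u (N v)) nbhC vNu /= => h.
rewrite addnCA add1n ltnS; apply: h; apply/subsetP => p; rewrite !inE.
case/and3P=> -> ep; rewrite ep /= => /orP[] /orP[] /eqP pE.
- by move: ep; rewrite pE => ->; rewrite orbT.
- by rewrite pE euv.
- by move: ep; rewrite pE es => ->.
- by rewrite pE euv orbT.
Qed.

(** * Edges meeting a neighbourhood, and the exclusion of inner vertices *)

Lemma span_inner_edge u v : u \in inner -> e u v -> (span e u v <= 7)%N.
Proof. by move=> ui euv; apply: leq_trans (span_le u v) (inner_edge_deg ui euv). Qed.

Lemma meeting_nbh_ge7 x : x \in inner -> (7 <= #|edges_meeting e (N x)|)%N.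
Proof.
move=> xi; rewrite leqNgt; apply/negP; rewrite ltnS => s6.
have n7 := card_gt7.
have in_edge p : p \in edges_meeting e (N x) -> (p.1 \in inner) && e p.1 p.2.
  rewrite inE => /and3P[_ ep pN]; rewrite ep andbT.
  case/orP: pN => /(inner_nbh xi) // p2; apply: inner_nbh p2 _.
  by rewrite inE es.
have le_w p : p \in edges_meeting e (N x) ->
    0 <= (n%:R - 7)^-1 - weight e p.1 p.2.
  move=> /in_edge/andP[p1 ep]; rewrite subr_ge0; apply: weight_le => //.
  by rewrite n7 span_inner_edge.
have n7r : 0 < (n%:R - 7)^-1 :> rat by rewrite invr_gt0 subr_gt0 ltr_nat.
(* At most 6 weights, each at most [1 / (n - 7)], add up to [6 / (n - 7)], so all of them attain the
   bound. *)
have sum0 : \sum_(p in edges_meeting e (N x)) ((n%:R - 7)^-1 - weight e p.1 p.2) = 0.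
  apply/eqP; rewrite eq_le sumr_ge0 // andbT sumrB sumr_const load_nbh.
  by rewrite subr_le0 -[leLHS]mulr_natl ler_pM2r // ler_nat.
have span7 y : y \in N x -> span e x y = 7%N.
  move=> yx; have exy : e x y by rewrite inE in yx.
  have xy : x != y by apply: contraTneq yx => ->; rewrite nbhx.
  have eqw : weight e x y = (n%:R - 7)^-1.
    have eyx : e y x by rewrite es.
    have w0 p : p \in edges_meeting e (N x) -> weight e p.1 p.2 = (n%:R - 7)^-1.
      move=> pE; apply/esym/eqP; rewrite -subr_eq0; move/eqP: sum0.
      rewrite psumr_eq0 // => /allP/(_ p); rewrite mem_index_enum pE.
      by move/(_ isT).
    have := w0 (x, y); have := w0 (y, x); rewrite !inE /= exy eyx ei /= !andbT.
    rewrite weightC; case: ltngtP => [_ h _|_ _ h|/val_inj/enum_rank_inj/eqP].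
    - exact: h.
    - exact: h.
    - by rewrite eq_sym (negbTE xy).
  have := spanT exy; move/(congr1 GRing.inv): eqw; rewrite !invrK => /addrI/oppr_inj.
  by move/eqP; rewrite eqr_nat => /eqP.
have deg7 y : y \in N x -> deg y = (7 - deg x)%N /\ N x :&: N y = set0.
  move=> yx; have exy : e x y by rewrite inE in yx.
  have := span7 y yx; rewrite /span cardsU; have := inner_edge_deg xi exy.
  have := subset_leq_card (subsetIl (N x) (N y)) => h1 h2 h3.
  by split; [|apply/eqP; rewrite -cards_eq0]; lia.
(* [N x] is independent, so every edge meeting it has exactly one end there. *)
have : (#|edges_meeting e (N x)| * 2 = deg x * ((7 - deg x) * 2))%N.
  rewrite card_meeting2 -sum_nat_const; apply: eq_bigr => y yx.
  have [<- disj] := deg7 y yx; rewrite -sum_nat_const; apply: eq_bigr => z zy.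
  case: ifP => // zx; suff : z \in set0 by rewrite inE.
  by rewrite -disj inE zx.
have /card_gt0P[y yx] := deg_gt0 x; have [degy _] := deg7 y yx.
have := inner_deg (inner_nbh xi yx); have := inner_deg xi.
rewrite degy => dx2 dx5 h; have dx : (deg x <= 5)%N by lia.
(* For [a] from 2 to 5 the product [a * (7 - a)] is 10 or 12, against at most 6 edges. *)
move: s6 dx2 dx5 h dx; move: (deg x) => a.
by case: a => [|[|[|[|[|[|a]]]]]] //; lia.
Qed.

Lemma inner_empty x : x \notin inner.
Proof.
apply/negP => xi.
have deg3 y : y \in inner -> (3 <= deg y)%N.
  move=> yi; rewrite ltn_neqAle inner_deg // andbT; apply/eqP => /esym/eqP.
  case/cards2P => u [v] [uv yuv].
  have ui : u \in inner by apply: inner_nbh yi _; rewrite yuv !inE eqxx.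
  have vi : v \in inner by apply: inner_nbh yi _; rewrite yuv !inE eqxx orbT.
  have := @meeting_pair_le6 y u v ui vi uv; rewrite -yuv => /(_ (subxx _)).
  by rewrite leqNgt meeting_nbh_ge7.
have [sum_le nE] := inner_deg_sum.
have : (14 <= \sum_(y in inner) deg y)%N.
  have -> : (\sum_(y in inner) deg y = #|edges_meeting e inner| * 2)%N.
    rewrite card_meeting2; apply: eq_bigr => u ui; rewrite -sum1_card.
    by apply: eq_bigr => v /(inner_nbh ui) ->.
  have : edges_meeting e (N x) \subset edges_meeting e inner.
    by apply: edges_meetingS; apply/subsetP => y; apply: inner_nbh.
  by move/subset_leq_card; have := meeting_nbh_ge7 xi; lia.
have : (#|inner| * 3 <= \sum_(y in inner) deg y)%N.
  by rewrite -sum_nat_const; apply: leq_sum => y /deg3.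
(* With w inner vertices and q centers, [w + q >= 8] and [w <= 2q - 2], so [q >= 4]. From [n = 26]
   on, [7 / (n - 4)] exceeds [6 / (n - 7)]. *)
move=> h1 h2; have n26 : (26 <= n)%N by lia.
have := load_nbh x; have : 7 / (n%:R - 4) <= load (N x).
  apply: (@le_trans _ _ ((#|edges_meeting e (N x)|)%:R / (n%:R - 4))).
    by rewrite ler_pM2r ?ler_nat ?meeting_nbh_ge7 // invr_gt0 subr_gt0 ltr_nat; lia.
  rewrite mulr_natl -sumr_const; apply: ler_sum => p pE.
  have ep := edges_meeting_edge pE; apply: weight_ge => //.
  apply: leq_trans (span_geS ep); rewrite ltnS; apply: deg3.
  move: pE; rewrite inE => /and3P[_ _] /orP[] /(inner_nbh xi) // p2.
  by apply: inner_nbh p2 _; rewrite inE es.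
move=> + lE; rewrite lE; have : 26%:R <= n%:R :> rat by rewrite ler_nat.
move: (n%:R : rat) => m m26; rewrite ler_pdivrMr; last by lra.
rewrite mulrAC ler_pdivlMr; last by lra.
lra.
Qed.

End LowBetweenness.

Local Close Scope ring_scope.

(** * Star components, locally and up to isomorphism *)

Lemma star_center_of_iso (T : finType) (e : rel T) (k : nat) (x : T) :
  symmetric e -> graph_iso (induced e (component e x)) (star k) ->
  exists c, star_center e k c.
Proof.
move=> es [f [g fK gK] fE]; pose c := val (g ord0).
(* Components are closed under adjacency, so neighbourhoods in [e] can be read off in the star. *)
have in_comp z y : z \in component e x -> e z y -> y \in component e x.
  by rewrite !inE => xz zy; apply: connect_trans xz (connect1 zy).
have nbhE y : y \in nbh e c -> exists2 u, val u = y & f u != ord0.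
  rewrite inE => cy; exists (Sub y (in_comp _ _ (valP (g ord0)) cy)) => //.
  have := fE (g ord0) (Sub y (in_comp _ _ (valP (g ord0)) cy)).
  rewrite /induced -/c /= cy gK /star eqxx.
  by case: (f _ == ord0).
exists c; split=> [|z /nbhE[u <- fu]].
  have -> : nbh e c = [set val (g i) | i in [set~ ord0]].
    apply/setP => y; apply/idP/imsetP => [/nbhE[u <- fu]|[i i0 ->]].
      by exists (f u); rewrite ?fK // !inE.
    rewrite inE -[e _ _]/(induced e _ (g ord0) (g i)) -fE !gK /star eqxx.
    by rewrite !inE in i0; rewrite (negbTE i0).
  rewrite card_imset; last by apply: inj_comp val_inj (can_inj gK).
  by rewrite cardsC1 card_ord.
apply/setP => w; rewrite !inE; apply/idP/eqP => [uw|->].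
  have wc := in_comp _ _ (valP u) uw.
  have := fE u (Sub w wc); rewrite /induced /= uw /star (negbTE fu).
  case: (f _ =P ord0) => // fw _; rewrite /c -[w]/(val (Sub w wc : {y | y \in component e x})).
  by rewrite -fw fK.
rewrite es -[e _ _]/(induced e _ (g ord0) u) -fE gK /star eqxx.
by rewrite (negbTE fu).
Qed.

Lemma star_center_closed (T : finType) (e : rel T) (k : nat) (c u v : T) :
  star_center e k c -> u \in c |: nbh e c -> e u v -> v \in c |: nbh e c.
Proof.
case=> _ leaf; rewrite !inE => /orP[/eqP->->|cu uv]; first by rewrite orbT.
have : v \in nbh e u by rewrite inE.
by rewrite leaf ?inE // => ->.
Qed.

Lemma component_star_center (T : finType) (e : rel T) (k : nat) (c x : T) :
  symmetric e -> star_center e k c -> x \in c |: nbh e c ->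
  component e x = c |: nbh e c.
Proof.
move=> es cP xA; apply/setP => y; rewrite inE; apply/idP/idP.
  move=> xy; rewrite -(closed_connect _ xy) //.
  apply: intro_closed => [|u v uv uA]; first exact: sym_connect_sym.
  exact: star_center_closed cP uA uv.
have to_c z : z \in c |: nbh e c -> connect e c z.
  by rewrite !inE => /orP[/eqP->|cz]; [apply: connect0 | apply: connect1].
move=> yA; apply: connect_trans (to_c _ yA).
by rewrite sym_connect_sym // to_c.
Qed.

(** Any enumeration of the leaves works; listing [c] first sends it to [ord0]. *)
Lemma star_center_iso (T : finType) (e : rel T) (k : nat) (c : T) :
  symmetric e -> irreflexive e -> star_center e k c ->
  graph_iso (induced e (c |: nbh e c)) (star k).
Proof.
move=> es ei [ck leaf]; set A := c |: nbh e c; set s := c :: enum (nbh e c).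
have As u : (u \in A) = (u \in s) by rewrite !inE mem_enum inE.
have ss : size s = k.+1 by rewrite /= -cardE ck.
pose f (u : {x | x \in A}) : 'I_k.+1 := inord (index (val u) s).
have fE u : f u = index (val u) s :> nat.
  by rewrite inordK // -ss index_mem -As (valP u).
have f0 u : (f u == ord0) = (val u == c).
  by rewrite -val_eqE /= fE /= [RHS]eq_sym; case: (c == _).
exists f => [|u v].
  apply: inj_card_bij => [u v /(congr1 val)|].
    rewrite /= !fE => uv; apply: val_inj.
    by rewrite -(nth_index c (s := s) (x := val u)) -?As ?(valP u) // uv nth_index // -As (valP v).
  by rewrite card_ord card_sig cardsU1 inE ei ck.
rewrite /star !f0 /induced; have := valP u; have := valP v.
rewrite !in_setU1; case: (eqVneq (val u) c) => [->|uc] /=.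
  by case: eqP => [->|_ /=]; rewrite ?ei // inE => ->.
case: eqP => [-> _|vc /= vN uN]; first by rewrite inE es => ->.
have := in_set1 (val v) c; rewrite -(leaf _ uN) inE => ->.
by apply/esym/negbTE/eqP.
Qed.

(** By connectedness [c] has a neighbour [z] in [e], which lies outside the star. The vertex [z] is
    missed by edges of the star, [c] by all other edges of [r]. *)
Lemma compl_span_ltn (T : finType) (e : rel T) (k : nat) (c u v : T) :
  let r := graph_compl e in
  symmetric e -> irreflexive e -> connected_graph e ->
  star_center r k.+1 c -> r u v -> span r u v < #|T|.
Proof.
move=> r es ei conn cP ruv; have [ck leaf] := cP.
have rs : symmetric r by move=> x y; rewrite /r /graph_compl eq_sym es.
have [z zA] : exists z, z \notin c |: nbh r c.
  have /card_gt0P[l] : 0 < #|nbh r c| by rewrite ck.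
  rewrite inE => /andP[cl _]; have /connectP[[|z p] /=] := conn c l.
    by move=> _ lc; rewrite lc eqxx in cl.
  case/andP=> cz _ _; exists z; rewrite !inE /r /graph_compl cz andbF orbF.
  by apply: contraTneq cz => ->; rewrite ei.
have lt_of x : x \notin nbh r u :|: nbh r v -> span r u v < #|T|.
  move=> xU; rewrite -cardsT; apply: proper_card; apply/properP.
  by split; [apply: subsetT | exists x].
have [uA|uA] := boolP (u \in c |: nbh r c).
  have vA := star_center_closed cP uA ruv.
  apply: (lt_of z); apply: contra zA => /setUP[]; rewrite inE.
    exact: star_center_closed cP uA.
  exact: star_center_closed cP vA.
apply: (lt_of c); apply: contra uA; rewrite in_setU inE.
case/orP => [uc|]; first by rewrite !inE rs uc orbT.
rewrite inE rs => cv; have : u \in nbh r v by rewrite inE rs.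
by rewrite leaf ?inE // => /eqP ->; rewrite eqxx.
Qed.

Theorem lemma31 (T : finType) (e : rel T) :
  exotic_coBUG e ->
  ~ exists x : T, graph_iso (induced e (component e x)) (star 6).
Proof.
case=> e0 [[b [[_ e0s e0i] conn between] b1] nstar] eE [x xiso].
have rs : symmetric (graph_compl e0).
  by move=> u v; rewrite /graph_compl eq_sym e0s.
have ri : irreflexive (graph_compl e0) by move=> u; rewrite /graph_compl eqxx.
have es : symmetric e by move=> u v; rewrite !eE rs.
have [c cP] : exists c, star_center (graph_compl e0) 6 c.
  have [c cP] := star_center_of_iso es xiso; exists c.
  have nE z : nbh (graph_compl e0) z = nbh e z by apply/setP => y; rewrite !inE eE.
  by case: cP => ck leaf; split=> [|z]; rewrite !nE //; apply: leaf.
have spanT u v := @compl_span_ltn _ e0 5 c u v e0s e0i conn cP.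
have betweenE y := etrans (esym (betweenness_compl y e0s spanT)) (between y).
(* No vertex is inner, so each one is a leaf or a center of a star, contrary to exoticness. *)
apply: nstar; exists 6 => y.
have [z zP yz] : exists2 z, star_center (graph_compl e0) 6 z
                         & y \in z |: nbh (graph_compl e0) z.
  have := inner_empty rs ri spanT betweenE b1 cP y.
  rewrite in_setC negbK in_setU => /orP[|yc]; last first.
    by exists y; [apply: (centerP rs ri spanT betweenE cP yc) | apply: setU11].
  rewrite inE => /cards1P[z yz]; exists z.
    exact: (leaf_center rs ri spanT betweenE cP yz).
  have : z \in nbh (graph_compl e0) y by rewrite yz set11.
  by rewrite in_setU1 !inE rs => ->; rewrite orbT.
by rewrite (component_star_center rs zP yz); apply: star_center_iso.
Qed.
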